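(* Let $\lambda$ be an infinite cardinal and $n$ a positive integer. Let $S$ be a semitopological inverse semigroup for which the inversion map $x\mapsto x'$ is continuous. If (an isomorphic copy of) $\mathscr{I}_\lambda^n$ is a subsemigroup of $S$, then it is a closed subset of $S$.
   Context: All topological spaces are assumed Hausdorff. A semitopological semigroup is a semigroup equipped with a Hausdorff topology for which all left translations $x\mapsto sx$ and all right translations $x\mapsto xs$ are continuous. An inverse semigroup is a semigroup in which each element $x$ has a unique inverse $x'$, i.e. a unique element with $xx'x=x$ and $x'xx'=x'$; a semitopological inverse semigroup is a semitopological semigroup that is algebraically an inverse semigroup. For a cardinal $\lambda$, $\mathscr{I}_\lambda$ denotes the symmetric inverse semigroup on the set $\lambda$: all one-to-one functions with domain and range subsets of $\lambda$ (including the empty transformation $0$), under composition $ab(x)=a(b(x))$ wherever defined. The rank of a transformation is the cardinality of its domain, and $\mathscr{I}_\lambda^n$ is the ideal of $\mathscr{I}_\lambda$ consisting of the transformations of rank at most $n$. *)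

(* Defs.v *)
From HB Require Import structures.
From mathcomp Require Import all_boot.
From mathcomp Require Import mathcomp_extra boolp classical_sets functions.
From mathcomp Require Import cardinality filter topology.

Set Implicit Arguments.
Unset Strict Implicit.
Unset Printing Implicit Defensive.

Local Open Scope classical_set_scope.
Local Open Scope card_scope.
Local Open Scope group_scope.

Definition is_inverse (S : magmaType) (x y : S) :=
  x * y * x = x /\ y * x * y = y.

(* An inverse semigroup carries its inversion map [invs]. Inverses are unique,
   so this map is determined by the multiplication. MathComp's [^-1] is not
   available here, since it presupposes a unit element. *)
HB.mixin Record Semigroup_isInverseSemigroup S of Semigroup S := {
  invs : S -> S;
  invsP : forall x : S, is_inverse x (invs x);
  invs_unique : forall x y : S, is_inverse x y -> y = invs x
}.

#[short(type="inverseSemigroupType")]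
HB.structure Definition InverseSemigroup :=
  {S of Semigroup_isInverseSemigroup S & Semigroup S}.

Bind Scope group_scope with InverseSemigroup.sort.

(* Continuity is only separate: it is required of each translation. *)
HB.mixin Record Semigroup_isSemitopological S
    of Semigroup S & Topological S := {
  semitop_hausdorff : hausdorff_space S;
  mulgl_continuous : forall s : S, continuous (fun x : S => s * x);
  mulgr_continuous : forall s : S, continuous (fun x : S => x * s)
}.

#[short(type="semitopSemigroupType")]
HB.structure Definition SemitopSemigroup :=
  {S of Semigroup_isSemitopological S & Semigroup S & Topological S}.

Bind Scope group_scope with SemitopSemigroup.sort.

#[short(type="semitopInverseSemigroupType")]
HB.structure Definition SemitopInverseSemigroup :=
  {S of SemitopSemigroup S & InverseSemigroup S}.

Bind Scope group_scope with SemitopInverseSemigroup.sort.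

Section SymmetricInverseSemigroup.
Variable L : Type.

(* A one-to-one partial transformation of L; [None] means "undefined". *)
Record pinj := PInj {
  pinj_fun :> L -> option L;
  pinj_inj : forall x y z,
    pinj_fun x = Some z -> pinj_fun y = Some z -> x = y
}.

Lemma pinj_ext (a b : pinj) : a =1 b -> a = b.
Proof.
case: a b => [f fi] [g gi] /= /funext fg; subst g.
by congr PInj; exact: Prop_irrelevance.
Qed.

HB.instance Definition _ := gen_eqMixin pinj.
HB.instance Definition _ := gen_choiceMixin pinj.

Lemma pinj_comp_subproof (a b : pinj) x y z :
  obind a (b x) = Some z -> obind a (b y) = Some z -> x = y.
Proof.
case bx: (b x) => [u|//]; case by_: (b y) => [v|//] /= au av.
have uv := pinj_inj au av; subst v.
exact: pinj_inj bx by_.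
Qed.

(* (a b)(x) = a (b x), defined exactly when b is defined at x and a at b x. *)
Definition pinj_comp (a b : pinj) : pinj :=
  PInj (@pinj_comp_subproof a b).

Lemma pinj_compA : associative pinj_comp.
Proof. by move=> a b c; apply: pinj_ext => x /=; case: (c x). Qed.

HB.instance Definition _ := isSemigroup.Build pinj pinj_compA.

Definition pinj_dom (a : pinj) : set L := [set x | a x <> None].

Definition rank_le (n : nat) : set pinj := [set a | pinj_dom a #<= `I_n].

Lemma rank_leMr n (a b : pinj) : rank_le n b -> rank_le n (a * b).
Proof.
apply: card_le_trans; apply: subset_card_le => x; rewrite /pinj_dom /=.
by case: (b x).
Qed.

Lemma rank_leMl n (a b : pinj) : rank_le n a -> rank_le n (a * b).
Proof.
apply: card_le_trans.
pose g x := odflt x (b x).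
have gi : {in pinj_dom (a * b) &, injective g}.
  move=> x y; rewrite !inE /pinj_dom /g /=.
  case bx: (b x) => [u|//]; case by_: (b y) => [v|//] /= _ _ uv; subst v.
  exact: pinj_inj bx by_.
rewrite -(card_le_eql (inj_card_eq gi)).
apply: subset_card_le => _ [x + <-]; rewrite /pinj_dom /g /=.
by case: (b x).
Qed.

Definition rank_le_pred (n : nat) : {pred pinj} := mem (rank_le n).

Lemma rank_le_mulg_closed n : mulg_closed (rank_le_pred n).
Proof. by move=> a b; rewrite !inE => ? _; exact: rank_leMl. Qed.

Record pinj_le (n : nat) := PInjLe {
  pinj_le_val :> pinj;
  _ : pinj_le_val \in rank_le_pred n
}.

HB.instance Definition _ n := [isSub for @pinj_le_val n].
HB.instance Definition _ n := [Choice of pinj_le n by <:].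
HB.instance Definition _ n :=
  SubChoice_isSubSemigroup.Build _ _ (pinj_le n) (@rank_le_mulg_closed n).

End SymmetricInverseSemigroup.

(* Main.v *)
(* By induction on k, the image T_k of the transformations of rank at most k is
   closed.  Let s be in the closure of T_(k+1) but not in T_(k+1).  For a fixed
   a in T_(k+1), only finitely many x in T_(k+1) have both ax and xa outside
   T_k, since their domain and range are confined to the range and domain of a;
   so as or sa lies in the closed set T_k, and hence so does sas.  As
   inversion is continuous, s' is a limit of such a, so s = ss's lies in T_k, a
   contradiction. *)
Require Import Defs.
From mathcomp Require Import all_boot finmap.
From mathcomp Require Import boolp classical_sets functions cardinality.
From mathcomp Require Import filter topology.

Set Implicit Arguments.
Unset Strict Implicit.
Unset Printing Implicit Defensive.

Local Open Scope classical_set_scope.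
Local Open Scope card_scope.
Local Open Scope group_scope.

Lemma finite_subsets (T : Type) (A : set T) :
  finite_set A -> finite_set [set B | B `<=` A].
Proof.
elim/Pchoice: T => T in A *; move=> /finite_fsetP[X ->].
apply: (@sub_finite_set _ _
  ((fun Y : {fset T} => [set` Y]) @` [set` fpowerset X])); last first.
  exact/finite_image/finite_fset.
move=> B BX; have finB : finite_set B by apply: sub_finite_set BX _.
exists (fset_set B); last by rewrite fset_setK.
rewrite /= fpowersetE; apply/fsubsetP => x.
by rewrite in_fset_set// inE => /BX.
Qed.

Lemma card_le_setD1 (T : Type) (A : set T) (x : T) (k : nat) :
  A x -> A #<= `I_k.+1 -> A `\ x #<= `I_k.
Proof.
move=> Ax /pcard_leP[f].
pose g y := if f y == k then f x else f y.
have fi y z : A y -> A z -> f y = f z -> y = z.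
  by move=> Ay Az; apply: 'inj_f; rewrite inE.
have gi : {in A `\ x &, injective g}.
  move=> y z; rewrite !inE /g => -[Ay yx] [Az zx].
  case: eqP => [fyk|fyk]; case: eqP => [fzk|fzk].
  - by move=> _; apply: fi => //; rewrite fyk.
  - by move/(fi _ _ Ax Az)/esym.
  - by move/(fi _ _ Ay Ax).
  - exact: fi.
rewrite -(card_le_eql (inj_card_eq gi)).
apply: subset_card_le => _ [y [Ay yx] <-] /=; rewrite /g.
have fA z : A z -> (f z < k.+1)%N by move=> Az; exact: (@funS _ _ A `I_k.+1 f).
case: eqP => [fyk|/eqP fyk]; last by rewrite ltn_neqAle fyk -ltnS fA.
rewrite ltn_neqAle -ltnS fA// andbT; apply/eqP => fxk.
by apply: yx; apply: fi => //; rewrite fyk.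
Qed.

Section PartialInjections.
Variable L : Type.
Implicit Types a b : pinj L.

Definition pinj_ran a : set L := [set y | exists x, a x = Some y].

Lemma rank_le_comp_dom k a b :
  rank_le k.+1 b -> ~ rank_le k (b * a) -> pinj_dom b `<=` pinj_ran a.
Proof.
move=> bk bak x bx; apply: contrapT => xa; apply: bak; rewrite /rank_le /=.
pose g y := odflt y (a y).
have gi : {in pinj_dom (b * a) &, injective g}.
  move=> y z; rewrite !inE /pinj_dom /g /=.
  case ay: (a y) => [u|//]; case az: (a z) => [v|//] /= _ _ uv; subst v.
  exact: pinj_inj ay az.
rewrite -(card_le_eql (inj_card_eq gi)).
apply: card_le_trans (card_le_setD1 bx bk).
apply: subset_card_le => _ [y + <-]; rewrite /pinj_dom /g /=.
case ay: (a y) => [u|//] /= bu; split=> // ux; subst u.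
by apply: xa; exists y.
Qed.

Lemma rank_le_comp_ran k a b :
  rank_le k.+1 b -> ~ rank_le k (a * b) -> pinj_ran b `<=` pinj_dom a.
Proof.
move=> bk abk y [x bx] ay; apply: abk; rewrite /rank_le /=.
have xb : pinj_dom b x by rewrite /pinj_dom /= bx.
apply: card_le_trans (card_le_setD1 xb bk).
apply: subset_card_le => z; rewrite /pinj_dom /=.
case bz: (b z) => [u|//] /= au; split=> // zx; apply: au; subst z.
by move: bz; rewrite bx => -[<-].
Qed.

Lemma finite_pinj_dom_ran (A B : set L) : finite_set A -> finite_set B ->
  finite_set [set b | pinj_dom b `<=` A /\ pinj_ran b `<=` B].
Proof.
move=> Afin Bfin.
pose graph b := [set p | b p.1 = Some p.2].
have graph_inj : {in [set b | pinj_dom b `<=` A /\ pinj_ran b `<=` B] &,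
    injective graph}.
  move=> b c _ _ /seteqP[bc cb]; apply: pinj_ext => x.
  case bx: (b x) => [y|]; first by rewrite (bc (x, y) bx).
  case cx: (c x) => [y|//].
  by rewrite -bx; exact: (cb (x, y) cx).
rewrite -(eq_finite_set (inj_card_eq graph_inj)).
apply: sub_finite_set (finite_subsets (finite_setX Afin Bfin)).
move=> _ [b [bA bB] <-] [x y] /= bx; split => /=.
  by apply: bA; rewrite /pinj_dom /= bx.
by apply: bB; exists x.
Qed.

Lemma finite_rank_le_comp k a : rank_le k.+1 a ->
  finite_set [set b | [/\ rank_le k.+1 b,
                          ~ rank_le k (a * b) & ~ rank_le k (b * a)]].
Proof.
move=> ak; have domfin : finite_set (pinj_dom a).
  by apply/finite_set_leP; exists k.+1.
have ranfin : finite_set (pinj_ran a).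
  apply: (@sub_finite_set _ _
    ((fun x => odflt x (a x)) @` pinj_dom a)); last exact: finite_image.
  by move=> y [x ax]; exists x; rewrite /pinj_dom /= ax.
apply: sub_finite_set (finite_pinj_dom_ran ranfin domfin).
move=> b [bk abk bak]; split; first exact: rank_le_comp_dom bk bak.
exact: rank_le_comp_ran bk abk.
Qed.

Definition pinj_inv_fun a (y : L) : option L :=
  if pselect (exists x, a x = Some y) is left e then Some (projT1 (cid e))
  else None.

Lemma pinj_inv_funP a x y : pinj_inv_fun a y = Some x <-> a x = Some y.
Proof.
rewrite /pinj_inv_fun; case: pselect => [e|ne]; last first.
  by split=> // ax; case: ne; exists x.
case: (cid e) => z /= az; split=> [[<-]//|ax].
by congr Some; exact: pinj_inj az ax.
Qed.

Lemma pinj_inv_inj a x y z :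
  pinj_inv_fun a x = Some z -> pinj_inv_fun a y = Some z -> x = y.
Proof. by move=> /pinj_inv_funP ax /pinj_inv_funP; rewrite ax => -[]. Qed.

Definition pinj_inv a : pinj L := PInj (@pinj_inv_inj a).

Lemma pinj_invP a : is_inverse a (pinj_inv a).
Proof.
have aKa x y : a x = Some y -> pinj_inv_fun a y = Some x.
  by move/pinj_inv_funP.
split; apply: pinj_ext => x /=.
  by case ax: (a x) => [y|//] /=; rewrite (aKa _ _ ax).
case ax: (pinj_inv_fun a x) => [y|//] /=.
by move/pinj_inv_funP: ax => ax; rewrite ax /= (aKa _ _ ax).
Qed.

Lemma rank_le_inv k a : rank_le k a -> rank_le k (pinj_inv a).
Proof.
by move=> ak; case: (pinj_invP a) => _ <-; apply/rank_leMl/rank_leMr.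
Qed.

Lemma finite_rank_le0 : finite_set [set a : pinj L | rank_le 0 a].
Proof.
apply: sub_finite_set (finite_pinj_dom_ran (finite_set0 L) (finite_set0 L)).
move=> a /=; rewrite /rank_le /= II0 card_le0 => /eqP a0; rewrite a0.
split=> // y [x ax]; suff: pinj_dom a x by rewrite a0.
by rewrite /pinj_dom /= ax.
Qed.

End PartialInjections.

Lemma closure_preimage_sub (T U : topologicalType) (f : T -> U) (A : set T)
    (C : set U) :
  continuous f -> closed C -> A `<=` f @^-1` C -> closure A `<=` f @^-1` C.
Proof.
move=> fc Cc AC; have /closure_id-> : closed (f @^-1` C).
  by move/continuous_closedP: fc; apply.
exact: closureS.
Qed.

Section Image.
Variables (L : Type) (n : nat) (S : semitopInverseSemigroupType).
Variable phi : {multiplicative pinj_le L n -> S}.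
Hypothesis invs_cont : continuous (@invs S).

Let T k : set S := phi @` [set a | rank_le k (val a)].

Let phiM a b : phi (a * b) = phi a * phi b.
Proof. exact: gmulfM. Qed.

Let finite_val_preimage (B : set (pinj L)) :
  finite_set B -> finite_set (phi @` [set a | B (val a)]).
Proof.
move=> Bfin; apply: finite_image; apply: card_le_finite Bfin.
by apply: (@card_ge_preimage _ _ B val) => a b _ _; exact: val_inj.
Qed.

Let finite_closed (B : set S) : finite_set B -> closed B.
Proof.
have /hausdorff_accessible := @semitop_hausdorff S.
by move/accessible_finite_set_closed; apply.
Qed.

Let T_mull k x y : T n x -> T k y -> T k (x * y).
Proof.
move=> [a _ <-] [b bk <-]; exists (a * b); last by rewrite phiM.
exact: rank_leMr.
Qed.

Let T_mulr k x y : T k x -> T n y -> T k (x * y).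
Proof.
move=> [a ak <-] [b _ <-]; exists (a * b); last by rewrite phiM.
exact: rank_leMl.
Qed.

Let in_T a : T n (phi a).
Proof. by exists a => //; case: a => a /=; rewrite inE. Qed.

Let T_sub k x : T k x -> T n x.
Proof. by move=> [a _ <-]. Qed.

Let T_inv k x : T k x -> T k (invs x).
Proof.
move=> [a ak <-]; have an : pinj_inv (val a) \in rank_le_pred n.
  by rewrite inE; apply: rank_le_inv; case: a {ak} => b /=; rewrite inE.
have [aba bab] := pinj_invP (val a).
exists (PInjLe an); first exact: rank_le_inv.
by apply: invs_unique; split; rewrite -!phiM; congr (phi _); apply: val_inj.
Qed.

Let mull_or_mulr_in_T k a s : closed (T k) -> closure (T k.+1) s ->
  ~ T k.+1 s -> T k.+1 a -> T k (a * s) \/ T k (s * a).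
Proof.
move=> Tkc sT sNT [b bk <-]; apply: contrapT => /not_orP[bs sb].
set F := phi @` [set c | [/\ rank_le k.+1 (val c),
  ~ rank_le k (val b * val c) & ~ rank_le k (val c * val b)]].
have Fc : closed F.
  exact: finite_closed (finite_val_preimage (finite_rank_le_comp bk)).
have /continuous_closedP/(_ _ Tkc) Lc := mulgl_continuous (phi b).
have /continuous_closedP/(_ _ Tkc) Rc := mulgr_continuous (phi b).
have /closure_id E := closedU (closedU Lc Rc) Fc.
have: closure (((fun x => phi b * x) @^-1` T k `|`
                (fun x => x * phi b) @^-1` T k) `|` F) s.
  apply: closureS sT => _ [c ck <-].
  have [bc|bc] := pselect (rank_le k (val b * val c)).
    by left; left; exists (b * c); rewrite ?phiM.
  have [cb|cb] := pselect (rank_le k (val c * val b)).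
    by left; right; exists (c * b); rewrite ?phiM.
  by right; exists c.
rewrite -E => -[[]//|[c [ck _ _] cs]].
by apply: sNT; exists c.
Qed.

Let closed_T_step k : closed (T k) -> closed (T k.+1).
Proof.
move=> Tkc s sT; apply: contrapT => sNT.
have Tns x : T k x -> T k (x * s).
  move=> xk; apply: (closure_preimage_sub
    (mulgl_continuous x) Tkc _ sT) => y /T_sub yn.
  exact: T_mulr.
have sTn x : T k x -> T k (s * x).
  move=> xk; apply: (closure_preimage_sub
    (mulgr_continuous x) Tkc _ sT) => y /T_sub yn.
  exact: T_mull.
have sas a : T k.+1 a -> T k (s * a * s).
  move=> ak; have [|] := mull_or_mulr_in_T Tkc sT sNT ak.
    by rewrite -mulgA; exact: sTn.
  exact: Tns.
have sas_cont : continuous (fun a => s * a * s).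
  move=> a; apply: (@continuous_comp _ _ _ (fun x => s * x) (fun x => x * s)).
    exact: mulgl_continuous.
  exact: mulgr_continuous.
have s'T : closure (T k.+1) (invs s).
  apply: (closure_preimage_sub invs_cont (@closed_closure _ _) _ sT).
  by move=> x /T_inv; exact: subset_closure.
have := closure_preimage_sub sas_cont Tkc sas s'T.
rewrite /= (invsP s).1 => -[a ak as_]; apply: sNT; exists a => //.
by apply: card_le_trans ak _; rewrite card_le_II.
Qed.

Lemma closed_range_pinj_le : closed (range phi).
Proof.
have Tc k : closed (T k).
  elim: k => [|k]; last exact: closed_T_step.
  exact: finite_closed (finite_val_preimage (@finite_rank_le0 L)).
have -> : range phi = T n by apply/seteqP; split=> [_ [a _ <-]|_ [a _ <-]].
exact: Tc.
Qed.

End Image.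

Theorem corollary11 (L : Type) (n : nat) (S : semitopInverseSemigroupType)
    (phi : {multiplicative pinj_le L n -> S}) :
  infinite_set [set: L] ->
  (0 < n)%N ->
  continuous (@invs S) ->
  injective phi ->
  closed (range phi).
Proof. by move=> _ _ invs_cont _; exact: closed_range_pinj_le. Qed.
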